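(* Let $\mathbf A$ be a finite algebra. The following are equivalent: (1) $c_{\mathbf A}(n) \in O(n^k)$ for some integer $k$; (2) no subalgebra of $\mathbf A$ (including $\mathbf A$ itself) has a nontrivial strongly abelian congruence.
   Context: An algebra is a set with interpretations of the function symbols of a purely functional signature (each symbol has a nonnegative integer arity). For a finite algebra $\mathbf A$, $c_{\mathbf A}(n)$ denotes the maximum of $|\mathrm{Hom}(\mathbf X,\mathbf A)|$ over all algebras $\mathbf X$ in the signature of $\mathbf A$ with at most $n$ elements. For an algebra $\mathbf A$ and $k\ge 1$, $\mathrm{Clo}_k(\mathbf A)$ is the set of $k$-ary term operations of $\mathbf A$. A congruence $\alpha$ of $\mathbf A$ is strongly abelian if for every $k\ge1$, every $t\in \mathrm{Clo}_k(\mathbf A)$ and all $x_1,\dots,x_k,y_1,\dots,y_k,z_2,\dots,z_k\in A$ with $(x_i,y_i)\in\alpha$ for $1\le i\le k$ and $(y_i,z_i)\in\alpha$ for $2\le i\le k$, the equality $t(x_1,\dots,x_k)=t(y_1,\dots,y_k)$ implies $t(x_1,z_2,\dots,z_k)=t(y_1,z_2,\dots,z_k)$. The congruence $0_A$ (equality) is the trivial congruence; all others are nontrivial. *)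

(* Defs.v *)
From HB Require Import structures.
From mathcomp Require Import all_boot.
From mathcomp Require Import boolp.
Set Implicit Arguments. Unset Strict Implicit. Unset Printing Implicit Defensive.

Record algebra (F : Type) (ar : F -> nat) := Algebra {
  carrier :> finType;
  op : forall f : F, ('I_(ar f) -> carrier) -> carrier
}.
Arguments op {F ar} a f _.

Section Defs.
Variables (F : Type) (ar : F -> nat).

Definition is_hom (X A : algebra ar) (h : X -> A) : Prop :=
  forall (f : F) (a : 'I_(ar f) -> X), h (op X f a) = op A f (fun i => h (a i)).

Definition Hom (X A : algebra ar) : {set {ffun X -> A}} :=
  [set h : {ffun X -> A} | `[< is_hom (fun x => h x) >] ].

(* "c_A(n) <= b": every algebra X with at most n elements has
   at most b homomorphisms into A (c_A(n) is the max of these numbers). *)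
Definition cA_le (A : algebra ar) (n b : nat) : Prop :=
  forall X : algebra ar, #|X| <= n -> #|Hom X A| <= b.

Definition cA_bigO_pow (A : algebra ar) (k : nat) : Prop :=
  exists C N : nat, forall n, N <= n -> cA_le A n (C * n ^ k).

Inductive term (k : nat) : Type :=
  | Var : 'I_k -> term k
  | App : forall f : F, ('I_(ar f) -> term k) -> term k.

Fixpoint eval_term (A : algebra ar) (k : nat) (t : term k) (v : 'I_k -> A) : A :=
  match t with
  | Var i => v i
  | App f ts => op A f (fun i => eval_term (ts i) v)
  end.

Definition Clo (A : algebra ar) (k : nat) (g : ('I_k -> A) -> A) : Prop :=
  exists t : term k, forall v, g v = eval_term t v.

Definition congruence (A : algebra ar) (alpha : A -> A -> Prop) : Prop :=
  [/\ (forall x, alpha x x),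
      (forall x y, alpha x y -> alpha y x),
      (forall x y z, alpha x y -> alpha y z -> alpha x z) &
      (forall (f : F) (a b : 'I_(ar f) -> A),
          (forall i, alpha (a i) (b i)) -> alpha (op A f a) (op A f b))].

Definition nontrivial_rel (A : algebra ar) (alpha : A -> A -> Prop) : Prop :=
  exists x y : A, x <> y /\ alpha x y.

(* strongly abelian: arguments indexed by 'I_k.+1 (k+1 >= 1), index ord0
   plays the role of the first argument x_1. *)
Definition strongly_abelian (A : algebra ar) (alpha : A -> A -> Prop) : Prop :=
  forall (k : nat) (t : ('I_k.+1 -> A) -> A), Clo t ->
  forall x y z : 'I_k.+1 -> A,
    (forall i, alpha (x i) (y i)) ->
    (forall i, i != ord0 -> alpha (y i) (z i)) ->
    t x = t y ->
    t (fun i => if i == ord0 then x ord0 else z i)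
    = t (fun i => if i == ord0 then y ord0 else z i).

Definition subuniverse (A : algebra ar) (B : {set A}) : Prop :=
  forall (f : F) (a : 'I_(ar f) -> A), (forall i, a i \in B) -> op A f a \in B.

Definition subalg (A : algebra ar) (B : {set A}) (HB : subuniverse B) : algebra ar :=
  @Algebra F ar {x : A | x \in B}
    (fun f a => exist _ (op A f (fun i => sval (a i)))
                      (HB f _ (fun i => svalP (a i)))).

End Defs.

(* Main.v *)
Require Import Defs.
From mathcomp Require Import all_boot.
From mathcomp Require Import boolp zify.
Set Implicit Arguments. Unset Strict Implicit. Unset Printing Implicit Defensive.

(** If a subalgebra B has a nontrivial strongly abelian congruence, take a <> b congruent,
    and let X be the subalgebra of B^({a,b}^m) generated by the m projections.  Strong
    abelianness bounds the number of essential variables of a term operation on {a,b}^m by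
    |B|, so |X| is polynomial in m, while the 2^m evaluations are homomorphisms.

    Conversely, at the cost of a polynomial factor one may fix the image B of the
    homomorphisms together with preimages of its elements; the set of evaluations is then an
    algebra containing the constants, closed under the polynomials of B.  A set S of
    homomorphisms is measured by the numbers of restrictions to S of evaluations composed with
    maps k : B -> option B.  Given two homomorphisms h1, h2 in S, tame congruence theory
    provides a minimal congruence alpha generated by the images of pairs (u h1, u h2), and an
    idempotent polynomial e on whose image every unary polynomial is a permutation or
    collapses alpha.  As alpha is not strongly abelian, some binary polynomial f has f(a,.) a
    permutation of the image of e and f(b,.) <> f(a,.) with (a,b) in alpha.  If f(b,.) is
    again a permutation, split S according to the permutation f(x h,.), all non-permutations
    being merged; otherwise f yields a meet operation and S is split according to whether
    x h = 1.  Either way, for any two pieces S1, S2 some measure m satisfies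
    8 m(S1) + m(S2) <= 8 m(S), so that |S| is bounded by a fixed power of the product of the
    measures of S. *)

(** * Combinatorial preliminaries *)

(** The orbit of [s] becomes periodic after [i < #|T|] steps, with period [o - i] at most [#|T|];
    the factorial is a multiple of the period and at least [i]. *)
Lemma iter_fact_idem (T : finType) (p : T -> T) (s : T) :
  iter #|T|`! p (iter #|T|`! p s) = iter #|T|`! p s.
Proof.
have /trajectP[i lt_i eq_i] : iter (fingraph.order p s) p s
    \in traject p s (fingraph.order p s) := looping_order p s.
have le_o : fingraph.order p s <= #|T| by apply: max_card.
set o := fingraph.order p s in lt_i eq_i le_o *.
have step j : i <= j -> iter (j + (o - i)) p s = iter j p s.
  move=> le_ij; rewrite -(subnK le_ij) -addnA subnKC ?(ltnW lt_i) //.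
  by rewrite iterD eq_i -iterD.
have steps q j : i <= j -> iter (j + q * (o - i)) p s = iter j p s.
  elim: q => [|q IHq] le_ij; first by rewrite mul0n addn0.
  by rewrite mulSn addnCA addnC step ?IHq // (leq_trans le_ij) ?leq_addr.
have /dvdnP[q eN] : (o - i) %| #|T|`! by apply: dvdn_fact; lia.
rewrite -iterD {2}eN steps //.
by apply: leq_trans (fact_geq _); lia.
Qed.

Lemma expn_Bernoulli a y n : a ^ n.+1 + n.+1 * a ^ n * y <= (a + y) ^ n.+1.
Proof.
elim: n => [|n IHn]; first by rewrite !expn1 expn0 !mul1n.
rewrite [in leqRHS]expnS; apply: leq_trans (leq_mul (leqnn _) IHn).
rewrite (expnS a n.+1) (expnS a n); move: (a ^ n) => b; nia.
Qed.

(** After scaling by [8 ^ (8 * r)], two terms of the expansion of [(8 * x + y) ^ (8 * r)] suffice: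
    the 8 in the exponent makes up for the 8 in front of [x]. *)
Lemma gap_expn r x y z : y <= x -> 8 * x + y <= 8 * z ->
  x ^ (8 * r) + r * y ^ (8 * r) <= z ^ (8 * r).
Proof.
case: r => [|r] le_yx le_z; first by rewrite muln0 mul0n !expn0.
set n := (8 * r.+1).-1; have en : 8 * r.+1 = n.+1 by rewrite /n; lia.
rewrite en -(leq_pmul2l (_ : 0 < 8 ^ n.+1)) ?expn_gt0 // mulnDr -!expnMn.
apply: leq_trans (_ : (8 * x + y) ^ n.+1 <= _); last by rewrite leq_exp2r.
apply: leq_trans (expn_Bernoulli _ _ _); rewrite leq_add2l -en.
have -> : 8 ^ (8 * r.+1) = 8 * 8 ^ n by rewrite en expnS.
have -> : y ^ (8 * r.+1) = y * y ^ n by rewrite en expnS.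
rewrite expnMn.
have : y ^ n <= x ^ n by rewrite leq_exp2r // /n; lia.
move: (8 ^ n) (y ^ n) (x ^ n) => b c d le_cd.
have -> : 8 * b * (r.+1 * (y * c)) = 8 * r.+1 * b * y * c by nia.
have -> : 8 * r.+1 * (b * d) * y = 8 * r.+1 * b * y * d by nia.
by rewrite leq_mul2l le_cd orbT.
Qed.

(** With [q j0] the largest and [n = 8 * #|J|], [gap_expn] bounds [#|J|] times any other term by
    [z ^ n - q j0 ^ n]. *)
Lemma sum_expn_gap (J : finType) (q : J -> nat) z :
  (forall j, q j <= z) ->
  (forall j j', j != j' -> 8 * q j + q j' <= 8 * z) ->
  \sum_j q j ^ (8 * #|J|) <= z ^ (8 * #|J|).
Proof.
move=> le_q gap; case: (pickP (@predT J)) => [j1 _ | J0]; last first.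
  by rewrite big_pred0.
have J_gt0 : 0 < #|J| by apply/card_gt0P; exists j1.
case: (arg_maxnP q (isT : predT j1)) => j0 _ max_j0.
rewrite (bigD1 j0) //= -leq_subRL ?leq_exp2r ?muln_gt0 //.
rewrite -(leq_pmul2l J_gt0) big_distrr /=.
apply: leq_trans (_ : \sum_(j | j != j0) (z ^ (8 * #|J|) - q j0 ^ (8 * #|J|)) <= _).
  apply: leq_sum => j ne_j.
  have := gap_expn #|J| (max_j0 j isT) (gap j0 j _); rewrite eq_sym ne_j => /(_ isT).
  by rewrite -leq_subRL ?leq_exp2r ?muln_gt0.
by rewrite sum_nat_const leq_mul2r max_card orbT.
Qed.

(** Fibre by fibre: one that meets [D] has at least two points in [E], one that misses [D] at least
    one. *)
Lemma leq_card_fibers (T1 T2 : finType) (r : T1 -> T2) (E D : {set T1}) :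
  D \subset E ->
  (forall v, v \in D -> exists2 v', v' \in E & v' != v /\ r v' = r v) ->
  #|D| + 2 * #|r @: E| <= 2 * #|E|.
Proof.
move=> sDE collD.
rewrite -[#|D|]sum1_card -[#|E|]sum1_card -[#|r @: E|]sum1_card.
rewrite (partition_big_imset r (mem E)) /=.
have -> : \sum_(i in D) 1 = \sum_(w in r @: E) \sum_(i in D | r i == w) 1.
  by apply: partition_big => i /(subsetP sDE); apply: imset_f.
rewrite !big_distrr /= -big_split /=; apply: leq_sum => w /imsetP[v Ev ->].
rewrite !sum1_card muln1.
change (#|[pred i in D | r i == r v]| + 2 <= 2 * #|[pred i in E | r i == r v]|).
have le_DE : #|[pred i in D | r i == r v]| <= #|[pred i in E | r i == r v]|.
  apply/subset_leq_card/subsetP => i; rewrite !inE => /andP[Di ->].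
  by rewrite (subsetP sDE).
case: (pickP [pred i in D | r i == r v]) => [i /andP[/= Di /eqP ri] | D0].
  have [i' Ei' [ne_i ri']] := collD _ Di.
  suff : 1 < #|[pred i in E | r i == r v]| by lia.
  apply/card_gt1P; exists i, i'; split; rewrite ?inE ?Ei' ?ri' ?ri ?eqxx //.
    by rewrite (subsetP sDE).
  by rewrite eq_sym.
rewrite eq_card0 //; suff : 0 < #|[pred i in E | r i == r v]| by lia.
by apply/card_gt0P; exists v; rewrite !inE Ev eqxx.
Qed.

Lemma connect_cross (T : finType) (e : rel T) (Q : pred T) x y :
  connect e x y -> Q x -> ~~ Q y ->
  exists s s', [/\ connect e x s, e s s', Q s & ~~ Q s'].
Proof.
case/connectP=> p; elim: p x => [|x' p IHp] x /=; first by move=> _ -> ->.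
case/andP=> exx' px' ey Qx nQy.
have [Qx'|nQx'] := boolP (Q x'); last by exists x, x'.
have [s [s' [cs ess' Qs Qs']]] := IHp _ px' ey Qx' nQy.
by exists s, s'; split=> //; apply: connect_trans (connect1 exx') cs.
Qed.

Definition upd (I : eqType) T (w : I -> T) i v := fun j => if j == i then v else w j.

Lemma updC (I : eqType) T (w : I -> T) i j u v : i != j ->
  upd (upd w i u) j v = upd (upd w j v) i u.
Proof.
move=> ne_ij; apply/funext=> k; rewrite /upd.
by have [->|//] := eqVneq k j; rewrite eq_sym (negPf ne_ij).
Qed.

Lemma upd_id (I : eqType) T (w : I -> T) i : upd w i (w i) = w.
Proof. by apply/funext=> k; rewrite /upd; case: eqP => [->|]. Qed.

Lemma upd_upd (I : eqType) T (w : I -> T) i u v : upd (upd w i u) i v = upd w i v.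
Proof. by apply/funext=> k; rewrite /upd; case: eqP. Qed.

Lemma upd_ind n T (P : ('I_n -> T) -> Prop) (w w' : 'I_n -> T) :
  P w ->
  (forall w0 i, (forall j, w0 j = w j \/ w0 j = w' j) -> w0 i = w i ->
     P w0 -> P (upd w0 i (w' i))) ->
  P w'.
Proof.
move=> Pw step; pose wm m := fun i : 'I_n => if i < m then w' i else w i.
have Pwm m : m <= n -> P (wm m).
  elim: m => [_|m IHm lt_mn]; first by rewrite (_ : wm 0 = w).
  rewrite (_ : wm m.+1 = upd (wm m) (Ordinal lt_mn) (w' (Ordinal lt_mn))).
    apply: step; last by apply: IHm; apply: ltnW.
      by move=> j; rewrite /wm; case: ifP; [right | left].
    by rewrite /wm ltnn.
  apply/funext=> i; rewrite /upd /wm ltnS leq_eqVlt -val_eqE /=.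
  by case: eqVneq => //= e_im; congr w'; apply: val_inj.
rewrite (_ : w' = wm n); first exact: Pwm.
by apply/funext=> i; rewrite /wm ltn_ord.
Qed.

(** * Polynomials, principal congruences and minimal sets *)

Section Polynomials.
Variables (F : Type) (ar : F -> nat) (A : algebra ar).

Inductive polynomial (V : Type) : ((V -> A) -> A) -> Prop :=
  | pol_var v : polynomial (fun w => w v)
  | pol_const c : polynomial (fun=> c)
  | pol_op f (ts : 'I_(ar f) -> (V -> A) -> A) :
      (forall i, polynomial (ts i)) ->
      polynomial (fun w => op A f (fun i => ts i w)).

Definition upol (p : A -> A) := polynomial (fun w : unit -> A => p (w tt)).

Definition bpol (f : A -> A -> A) :=
  polynomial (fun w : bool -> A => f (w true) (w false)).

Lemma pol_subst (V V' : Type) p (q : V -> (V' -> A) -> A) :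
  polynomial p -> (forall v, polynomial (q v)) ->
  polynomial (fun w => p (fun v => q v w)).
Proof.
move=> pP qP; elim: pP => {p} [v | s | f ts _ IHts]; first exact: qP.
  exact: pol_const.
exact: (pol_op (ts := fun i w => ts i (fun v => q v w))).
Qed.

Lemma pol_upol (V : Type) p (q : (V -> A) -> A) :
  upol p -> polynomial q -> polynomial (fun w => p (q w)).
Proof. by move=> pP qP; apply: (pol_subst (q := fun=> q) pP). Qed.

Lemma pol_bpol (V : Type) f (q r : (V -> A) -> A) :
  bpol f -> polynomial q -> polynomial r -> polynomial (fun w => f (q w) (r w)).
Proof.
move=> fP qP rP.
by apply: (pol_subst (q := fun b : bool => if b then q else r) fP); case.
Qed.

Lemma upol_iter p n : upol p -> upol (iter n p).
Proof.
move=> pP; elim: n => [|n IHn]; first exact: pol_var.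
exact: (pol_upol (q := fun w => iter n p (w tt))).
Qed.

Lemma bpol_iter f n : bpol f -> bpol (fun x => iter n (f x)).
Proof.
move=> fP; elim: n => [|n IHn]; first exact: (pol_var false).
exact: (pol_bpol (r := fun w => iter n (f (w true)) (w false)) fP (pol_var true)).
Qed.

Lemma bpol_fix f a : bpol f -> upol (f a).
Proof. by move=> fP; exact: (pol_bpol (q := fun=> a) fP (pol_const _ a) (pol_var tt)). Qed.

Lemma pol_upd (V : eqType) (V' : Type) (T : (V -> A) -> A)
    (q : (V' -> A) -> V -> A) i (r : (V' -> A) -> A) :
  polynomial T -> (forall v, polynomial (fun w => q w v)) -> polynomial r ->
  polynomial (fun w => T (upd (q w) i (r w))).
Proof.
move=> TP qP rP; apply: (pol_subst (q := fun v w => upd (q w) i (r w) v) TP) => v.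
by rewrite /upd; case: eqP.
Qed.

Lemma pol_term k (t : term ar k) : polynomial (fun w => eval_term t w).
Proof. by elim: t => [v | f ts IHts] /=; [apply: pol_var | apply: pol_op]. Qed.

Definition cstep a b : rel A := fun s s' =>
  `[< exists2 p, upol p & (s = p a /\ s' = p b) \/ (s = p b /\ s' = p a) >].

(* By Maltsev's lemma this is the congruence generated by the pair (a, b). *)
Definition Cg a b : rel A := connect (cstep a b).

Lemma Cg_sym a b : symmetric (Cg a b).
Proof.
apply: sym_connect_sym => s s'.
by apply/asboolP/asboolP=> -[p pP [[-> ->]|[-> ->]]]; exists p; auto.
Qed.

Lemma Cg_trans a b : transitive (Cg a b). Proof. exact: connect_trans. Qed.

Lemma Cg_refl a b s : Cg a b s s. Proof. exact: connect0. Qed.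

Lemma Cg_gen a b : Cg a b a b.
Proof. by apply/connect1/asboolP; exists id; [exact: (pol_var tt) | by left]. Qed.

Lemma Cg_upol a b p s s' : upol p -> Cg a b s s' -> Cg a b (p s) (p s').
Proof.
move=> pP /connectP[q]; elim: q s => [|s1 q IHq] s /=; first by move=> _ ->; exact: Cg_refl.
case/andP=> /asboolP[r rP e] pq es'; apply: Cg_trans (IHq _ pq es').
apply/connect1/asboolP; exists (p \o r).
  exact: (pol_upol (q := fun w => r (w tt))).
by case: e => -[-> ->]; [left | right].
Qed.

Lemma Cg_min a b s s' : Cg a b s s' -> subrel (Cg s s') (Cg a b).
Proof.
move=> ss'; apply: connect_sub => x y /asboolP[p pP]; rewrite -/(Cg a b).
by case=> -[-> ->]; [|rewrite Cg_sym]; apply: Cg_upol.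
Qed.

Lemma Cg_congruence a b : congruence (A := A) (Cg a b).
Proof.
split=> [x|x y|x y z|f s s' ss']; first exact: Cg_refl.
- by rewrite Cg_sym.
- exact: Cg_trans.
apply: (upd_ind (w := s) (w' := s') (P := fun w => Cg a b (op A f s) (op A f w))).
  exact: Cg_refl.
move=> w i wP wi opw; apply: Cg_trans opw _; rewrite -{1}(upd_id w i).
apply: (Cg_upol (p := fun x => op A f (upd w i x))); last by rewrite wi; apply: ss'.
apply: (pol_op (ts := fun j w' => upd w i (w' tt) j)) => j; rewrite /upd.
by case: eqP => _; [apply: pol_var | apply: pol_const].
Qed.

Lemma Cg_pol a b (V : Type) p (w w' : V -> A) :
  polynomial p -> (forall v, Cg a b (w v) (w' v)) -> Cg a b (p w) (p w').
Proof.
move=> pP ww'; elim: pP => {p} [v | s | f ts _ IHts] //; first exact: Cg_refl.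
by have [_ _ _] := Cg_congruence a b; apply.
Qed.

Lemma Cg_bpol a b f s s' u u' :
  bpol f -> Cg a b s s' -> Cg a b u u' -> Cg a b (f s u) (f s' u').
Proof.
move=> fP ss' uu'.
apply: (Cg_pol (w := fun b : bool => if b then s else u)
               (w' := fun b : bool => if b then s' else u') fP).
by case.
Qed.

(** [Cg a b] consists of chains of polynomial images of the pair [(a, b)]; the link where the chain
    leaves [Q] supplies [p]. *)
Lemma Cg_cross a b (Q : pred A) s s' : Cg a b s s' -> Q s -> ~~ Q s' ->
  exists2 p, upol p & Q (p a) != Q (p b).
Proof.
move=> ss' Qs Qs'; have [x [x' [_ /asboolP[p pP e] Qx Qx']]] := connect_cross ss' Qs Qs'.
by exists p => //; case: e Qx Qx' => -[-> ->]; do 2!case: (Q _).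
Qed.

(** Among the nontrivial principal congruences below [Cg a b], one with the fewest pairs is
    generated by each of its nontrivial pairs. *)
Lemma Cg_atom a b : a != b -> exists c d,
  [/\ c != d, Cg a b c d &
      forall s s', Cg c d s s' -> s != s' -> subrel (Cg c d) (Cg s s')].
Proof.
move=> ne_ab; pose P (x : A * A) := (x.1 != x.2) && Cg a b x.1 x.2.
pose M (x : A * A) := #|[set y : A * A | Cg x.1 x.2 y.1 y.2]|.
have Pab : P (a, b) by rewrite /P ne_ab Cg_gen.
case: (arg_minnP M Pab) => -[c d] /andP[/= ne_cd cd] min_cd.
exists c, d; split=> // s s' ss' ne_ss'.
have sub : [set y : A * A | Cg s s' y.1 y.2] \subset [set y : A * A | Cg c d y.1 y.2].
  by apply/subsetP=> y; rewrite !inE; apply: Cg_min.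
have /eqP/setP eqC : [set y : A * A | Cg s s' y.1 y.2] == [set y : A * A | Cg c d y.1 y.2].
  rewrite eqEcard sub; apply: (min_cd (s, s')).
  by rewrite /P /= ne_ss' (Cg_min cd).
by move=> x y xy; have := eqC (x, y); rewrite !inE /= xy.
Qed.

(* The image of [e] is a minimal set, in the sense of tame congruence theory, of
   the minimal congruence [Cg c d]; a polynomial on it is a permutation of it iff
   it separates a pair of congruent elements. *)
Record minimal_set (e : A -> A) (c d : A) : Prop := MinimalSet {
  ms_pol : upol e;
  ms_idem : forall s, e (e s) = e s;
  ms_c : e c = c;
  ms_d : e d = d;
  ms_neq : c != d;
  ms_atom : forall s s', Cg c d s s' -> s != s' -> subrel (Cg c d) (Cg s s');
  ms_dich : forall p, upol p ->
    (forall s, p (e s) = p s) -> (forall s, e (p s) = p s) ->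
    forall s s', Cg c d s s' -> p s != p s' -> forall u u', p u = p u' -> e u = e u' }.

(** Let [f] have the smallest image [R] among the polynomials that do not collapse the atom. Some
    [g], the composite of [f] after a polynomial [p], still separates a congruent pair inside [R];
    by minimality it permutes [R], and a power of it is a retraction onto [R]. *)
Lemma minimal_set_exists a b : a != b ->
  exists e c d, minimal_set e c d /\ Cg a b c d.
Proof.
move=> /Cg_atom[c [d [ne_cd cd atom]]].
pose P (f : {ffun A -> A}) := `[< upol f >] && [exists s, exists s', Cg c d s s' && (f s != f s')].
have PP (f : A -> A) s s' : upol f -> Cg c d s s' -> f s != f s' -> P [ffun x => f x].
  move=> fP ss' ne_f; apply/andP; split.
    by apply/asboolP; rewrite (_ : fun_of_fin _ = f) //; apply/funext=> x; rewrite ffunE.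
  by apply/existsP; exists s; apply/existsP; exists s'; rewrite ss' !ffunE.
have Pid : P [ffun x => x] by apply: (PP id c d) => //; [apply: pol_var | apply: Cg_gen].
case: (arg_minnP (fun f : {ffun A -> A} => #|f @: A|) Pid) => f.
case/andP=> /asboolP fP /existsP[s /existsP[s' /andP[ss' ne_f]]] min_f.
have {}min_f p x x' : upol p -> Cg c d x x' -> p x != p x' -> #|f @: A| <= #|p @: A|.
  move=> pP xx' ne_p; apply: leq_trans (min_f _ (PP _ _ _ pP xx' ne_p)) _.
  by apply/subset_leq_card/subsetP=> y /imsetP[z _ ->]; rewrite ffunE imset_f.
have ff' : Cg c d (f s) (f s') by apply: Cg_upol.
have ne_f' : ~~ (f s' == f s) by rewrite eq_sym.
have [p pP] := Cg_cross (Q := fun x => f x == f s) (atom _ _ ff' ne_f _ _ ss') (eqxx _) ne_f'.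
have gP : upol (fun x => f (p x)) by apply: (pol_upol (q := fun w => p (w tt))).
set g := fun x => f (p x) in gP => ne_pf.
have ne_gf : g (f s) != g (f s').
  by rewrite /g; apply: contraNneq ne_pf => ->; rewrite eqxx.
set R := f @: A.
have gA x : g x \in R by apply: imset_f.
have gR : g @: R = R.
  apply/eqP; rewrite eqEcard; apply/andP; split.
    by apply/subsetP=> _ /imsetP[x _ ->].
  have -> : g @: R = (fun x => g (f x)) @: A.
    apply/setP=> y; apply/imsetP/imsetP=> -[x].
      by case/imsetP=> z _ -> ->; exists z.
    by move=> _ ->; exists (f x) => //; apply: imset_f.
  apply: (min_f _ s s') => //.
  exact: (pol_upol (q := fun w => f (w tt)) gP).
pose e := iter #|A|`! g.
have eA x : e x \in R by rewrite /e -(prednK (fact_gt0 _)) /=.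
have eR : e @: R = R.
  rewrite /e; elim: _`! => [|n IHn] /=; first exact: imset_id.
  by rewrite (imset_comp g (iter n g)) IHn.
have eidem x : e (e x) = e x by apply: iter_fact_idem.
have efix x : x \in R -> e x = x by rewrite -eR => /imsetP[y _ ->].
have atom' : forall x x', Cg c d x x' = Cg (f s) (f s') x x'.
  by move=> x x'; apply/idP/idP; [apply: atom | apply: Cg_min].
exists e, (f s), (f s'); split; last exact: Cg_min ff'.
split=> //; first exact: upol_iter.
- by apply/efix/imset_f.
- by apply/efix/imset_f.
- by move=> x x'; rewrite -atom' => xx' ne x1 x2; rewrite -atom'; apply: atom.
move=> q qP qe eq x x'; rewrite -atom' => xx' ne_q u u' eq_q.
have qR : q @: R = R.
  apply/eqP; rewrite eqEcard; apply/andP; split.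
    by apply/subsetP=> _ /imsetP[y _ ->]; rewrite -eq.
  apply: leq_trans (min_f _ _ _ qP xx' ne_q) _.
  by apply/subset_leq_card/subsetP=> _ /imsetP[y _ ->]; rewrite -qe imset_f.
have /imset_injP injq : #|q @: R| == #|R| by rewrite qR.
by apply: injq => //; rewrite !qe.
Qed.

End Polynomials.

Arguments pol_var {F ar A V} v.
Arguments pol_const {F ar A V} c.

(** * Rigidity implies strong abelianness *)

Section StronglyAbelian.
Variables (F : Type) (ar : F -> nat) (A : algebra ar) (e : A -> A) (c d : A).
Hypothesis ms : minimal_set e c d.

(** Each [f x] is a self-map of the minimal set, extended to [A] through [e]; [inj_ms] says that
    such a map permutes the minimal set. *)
Definition into_ms (f : A -> A -> A) :=
  [/\ bpol f, forall x u, f x (e u) = f x u & forall x u, e (f x u) = f x u].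

Definition inj_ms (p : A -> A) := forall u u', p u = p u' -> e u = e u'.

Lemma inj_ms_sep (p : A -> A) s s' : upol p ->
  (forall s, p (e s) = p s) -> (forall s, e (p s) = p s) ->
  Cg c d s s' -> p s != p s' -> inj_ms p.
Proof. by move=> pP pe ep ss' ne_p u u'; apply: (ms_dich ms pP pe ep ss' ne_p). Qed.

Lemma not_inj_ms (p : A -> A) s s' : upol p ->
  (forall s, p (e s) = p s) -> (forall s, e (p s) = p s) ->
  ~ inj_ms p -> Cg c d s s' -> p s = p s'.
Proof.
move=> pP pe ep ninj ss'; apply/eqP; apply/negPn/negP => ne_p.
exact/ninj/(inj_ms_sep pP pe ep ss' ne_p).
Qed.

(** A failure of strong abelianness is carried to a polynomial [T] with values in the minimal set.
    Rigidity keeps [T] from depending on two coordinates at once, so its dependence on coordinate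
    [a] survives when the others are taken from [x] or from [y], against [T x = T y]. *)
Lemma strongly_abelian_Cg :
  (forall f, into_ms f -> forall a b, Cg c d a b -> inj_ms (f a) -> f b =1 f a) ->
  strongly_abelian (Cg c d).
Proof.
move=> rigid k t [t0 tE] x y z xy yz eq_t.
have [[[_ sym trans _] atom] eP] := (Cg_congruence c d, ms_atom ms, ms_pol ms).
have {}tE : t = eval_term t0 by apply/funext.
have tP : polynomial t by rewrite tE; apply: pol_term.
set a := ord0 in yz *.
have -> : (fun i => if i == a then x a else z i) = upd z a (x a) by [].
have -> : (fun i => if i == a then y a else z i) = upd z a (y a) by [].
apply/eqP/negPn/negP => ne_t.
have ss' : Cg c d (t (upd z a (x a))) (t (upd z a (y a))).
  by apply: Cg_pol => // i; rewrite /upd; case: ifP => _; [apply: xy | apply: Cg_refl].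
have [p pP] : exists2 p, upol p & e (p (t (upd z a (x a)))) != e (p (t (upd z a (y a)))).
  have [||p pP ne_p] := Cg_cross (Q := fun s => e s == c) (atom _ _ ss' ne_t _ _ (Cg_gen c d)).
  - by rewrite (ms_c ms).
  - by rewrite (ms_d ms) eq_sym (ms_neq ms).
  by exists p => //; apply: contraNneq ne_p => ->.
pose T w := e (p (t w)); rewrite -![e (p _)]/(T _) => {ne_t}ne_T.
have {}eq_t : T x = T y by rewrite /T eq_t.
have TP : polynomial T by apply: (pol_upol eP); apply: (pol_upol pP).
have eT w : e (T w) = T w by apply: (ms_idem ms).
(* Dependence on the variable [i] is witnessed by a permutation of the minimal set. *)
have dep w i s s' : Cg c d s s' -> T (upd w i s) != T (upd w i s') ->
    exists2 r, upol r &
      [/\ Cg c d s (r c), Cg c d s (r d) & inj_ms (fun u => T (upd w i (r (e u))))].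
  move=> {}ss' ne_s; pose Q v := T (upd w i v) == T (upd w i s).
  have [||v [v' [sv vv' Qv Qv']]] := connect_cross (x := s) (y := s') (Q := Q) ss'.
  - by rewrite /Q.
  - by rewrite /Q eq_sym.
  case/asboolP: vv' => r rP evv'; exists r => //.
  have cd : Cg c d (r c) (r d) by apply: Cg_upol (Cg_gen c d).
  have src : Cg c d s (r c).
    by case: evv' sv => -[-> _] // /trans; apply; rewrite Cg_sym.
  split=> //; first exact: trans cd.
  have fP : upol (fun u => T (upd w i (r (e u)))).
    apply: (pol_upd (q := fun _ => w) i TP) => [v0|]; first exact: pol_const.
    by apply: pol_upol rP _.
  apply: (inj_ms_sep (s := c) (s' := d) fP) => [u|u||]; rewrite ?(ms_idem ms) ?(Cg_gen c d) //.
  rewrite (ms_c ms) (ms_d ms); apply: contraNneq Qv' => eq_r.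
  by case: evv' Qv => -[-> ->]; rewrite /Q eq_r.
have move1 w i j r v : i != j -> upol r -> Cg c d (w j) v ->
    inj_ms (fun u => T (upd w i (r (e u)))) ->
    forall u, T (upd (upd w j v) i (r (e u))) = T (upd w i (r (e u))).
  move=> ne_ij rP wv inj u.
  have fP : into_ms (fun x u => T (upd (upd w j x) i (r (e u)))).
    split=> [|x0 u0|x0 u0]; rewrite ?(ms_idem ms) //.
    apply: (pol_upd (q := fun w0 => upd w j (w0 true)) i TP) => [v0|].
      by rewrite /upd; case: eqP => _; [apply: pol_var | apply: pol_const].
    apply: pol_upol rP _; apply: pol_upol eP _; exact: pol_var.
  by rewrite (rigid _ fP _ _ wv) ?upd_id.
(* If [T] depended on both coordinates, then with coordinate [i] set to [r c] it would be constant
   along [j], by [move1] for [i], and yet separate [r' c] from [r' d], by [move1] for [j]. *)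
have indep w i j s s' v : i != j -> Cg c d (w i) s -> Cg c d s s' -> Cg c d (w j) v ->
    T (upd w i s) != T (upd w i s') -> T (upd w j v) = T w.
  move=> ne_ij ws {}ss' wv ne_s; apply/eqP/negPn/negP; rewrite eq_sym => ne_v.
  have [r rP [src srd injr]] := dep _ _ _ _ ss' ne_s.
  have [|r' rP' [wrc wrd injr']] := dep w j (w j) v wv; first by rewrite upd_id.
  have wr : Cg c d (w i) (r c) by apply: trans src.
  have fixr s0 : Cg c d (w j) s0 -> T (upd (upd w j s0) i (r (e c))) = T (upd w i (r (e c))).
    by move=> ws0; apply: move1.
  have fixr' := move1 w j i r' (r c) _ rP' wr injr'.
  rewrite eq_sym in ne_ij; move: fixr' => /(_ ne_ij) fixr'.
  have := injr' c d; rewrite -!fixr' (ms_c ms) (ms_d ms).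
  rewrite eq_sym in ne_ij.
  rewrite !(updC _ _ _ ne_ij) -(ms_c ms) !fixr ?(ms_c ms) // => /(_ erefl) /eqP.
  by rewrite (negPf (ms_neq ms)).
have zx i : i != a -> Cg c d (z i) (x i).
  by move=> ne_i; rewrite Cg_sym; apply: trans (xy i) (yz i ne_i).
have zy i : i != a -> Cg c d (z i) (y i).
  by move=> ne_i; rewrite Cg_sym; apply: yz.
have main w' : (forall i, i != a -> Cg c d (z i) (w' i)) ->
    T (upd w' a (x a)) = T (upd z a (x a)) /\ T (upd w' a (y a)) = T (upd z a (y a)).
  move=> zw'; pose P w := T (upd w a (x a)) = T (upd z a (x a)) /\
                          T (upd w a (y a)) = T (upd z a (y a)).
  apply: (upd_ind (w := z) (w' := w') (P := P)) => // w i _ wi [Px Py].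
  have [-> | ne_ia] := eqVneq i a; first by rewrite /P !upd_upd.
  rewrite /P !(updC _ _ _ ne_ia); rewrite eq_sym in ne_ia.
  have ne_w : T (upd w a (x a)) != T (upd w a (y a)) by rewrite Px Py.
  have wiw' : Cg c d (w i) (w' i) by rewrite wi; apply: zw'; rewrite eq_sym.
  have updE v : upd w a v i = w i by rewrite /upd eq_sym (negPf ne_ia).
  have updaE v : upd w a v a = v by rewrite /upd eqxx.
  split.
    rewrite -Px; apply: (indep _ a i (x a) (y a)) => //; rewrite ?updE ?updaE ?upd_upd //.
    exact: Cg_refl.
  rewrite -Py; apply: (indep _ a i (x a) (y a)) => //; rewrite ?updE ?updaE ?upd_upd //.
  by rewrite Cg_sym.
have := ne_T; rewrite -(main x zx).1 -(main y zy).2 !upd_id eq_t.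
by rewrite eqxx.
Qed.

End StronglyAbelian.

(** * Counting traces *)

Lemma prod_gap (I : finType) (m m1 m2 : I -> nat) (i0 : I) :
  (forall i, m1 i <= m i) -> (forall i, m2 i <= m i) ->
  8 * m1 i0 + m2 i0 <= 8 * m i0 ->
  8 * (\prod_i m1 i) + \prod_i m2 i <= 8 * \prod_i m i.
Proof.
move=> le1 le2 gap; have split (f : I -> nat) : \prod_i f i = f i0 * \prod_(i | i != i0) f i by exact: bigD1.
rewrite !split.
have := leq_prod (r := index_enum I) (P := predC1 i0) (fun i _ => le1 i).
have := leq_prod (r := index_enum I) (P := predC1 i0) (fun i _ => le2 i).
rewrite /=; move: (\prod_(i | i != i0) m1 i) (\prod_(i | i != i0) m2 i)
  (\prod_(i | i != i0) m i) => p1 p2 p le2p le1p.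
rewrite !mulnA; apply: leq_trans (leq_mul gap (leqnn p)).
by rewrite mulnDl; apply: leq_add; apply: leq_mul.
Qed.

Section Counting.
Variables (H A : finType) (XX : {set {ffun H -> A}}).
(* [None] outside [S]; inside [S], the inner [None] is the class of values that [k] forgets. *)
Definition trace (k : A -> option A) (S : {set H}) (u : {ffun H -> A}) :
    {ffun H -> option (option A)} :=
  [ffun h => if h \in S then Some (k (u h)) else None].

Definition ntraces k S := #|trace k S @: XX|.

Definition restrict (S : {set H}) (w : {ffun H -> option (option A)}) :
    {ffun H -> option (option A)} := [ffun h => if h \in S then w h else None].

Lemma restrict_trace k (S S' : {set H}) u : S' \subset S ->
  restrict S' (trace k S u) = trace k S' u.
Proof.
move=> /subsetP sS'; apply/ffunP=> h; rewrite !ffunE.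
by case: ifP => // /sS' ->.
Qed.

Lemma restrict_traces k (S S' : {set H}) : S' \subset S ->
  restrict S' @: (trace k S @: XX) = trace k S' @: XX.
Proof.
move=> sS'; rewrite -imset_comp; apply: eq_imset => u /=.
exact: restrict_trace.
Qed.

Lemma ntraces_sub k (S S' : {set H}) : S' \subset S -> ntraces k S' <= ntraces k S.
Proof. by move=> sS'; rewrite /ntraces -(restrict_traces k sS') leq_imset_card. Qed.

Lemma ntraces_le k S : ntraces k S <= #|XX|.
Proof. exact: leq_imset_card. Qed.

Lemma trace_eqP k (S : {set H}) (u u' : {ffun H -> A}) :
  reflect {in S, forall h, k (u h) = k (u' h)} (trace k S u == trace k S u').
Proof.
apply: (iffP eqP) => [/ffunP e h hS | e].
  by have := e h; rewrite !ffunE hS => -[].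
by apply/ffunP=> h; rewrite !ffunE; case: ifP => // /e ->.
Qed.

(* A trace on [S1] with two extensions to [S] is a surplus of [S] over [S1]; the
   hypotheses produce as many of these as a quarter of the traces on [S2]. *)
Lemma ntraces_gap k (sg : option A -> option A) (S S1 S2 : {set H}) (u0 : {ffun H -> A}) :
  S1 \subset S -> S2 \subset S ->
  u0 \in XX -> (exists2 h, h \in S2 & k (u0 h) != None) ->
  (forall (u : {ffun H -> A}) h0, u \in XX -> h0 \in S2 -> k (u h0) != None ->
     exists z z' : {ffun H -> A}, [/\ z \in XX, z' \in XX, {in S1, forall h, k (z h) = k (z' h)},
       exists2 h, h \in S2 & k (z h) != k (z' h) &
       {in S2, forall h, k (u h) = k (z h)} \/
       {in S2, forall h, k (u h) = sg (k (z h))}]) ->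
  8 * ntraces k S1 + ntraces k S2 <= 8 * ntraces k S.
Proof.
move=> sS1 sS2 Xu0 [h0 h0S u0h0] gain.
pose E := trace k S @: XX; pose E2 := trace k S2 @: XX.
pose D := [set v in E | [exists v' in E, (v' != v) && (restrict S1 v' == restrict S1 v)]].
have sDE : D \subset E by apply/subsetP=> v; rewrite inE => /andP[].
have le_D : #|D| + 2 * ntraces k S1 <= 2 * ntraces k S.
  rewrite /ntraces -(restrict_traces k sS1).
  apply: leq_card_fibers sDE _ => v.
  by rewrite inE => /andP[_ /existsP[v' /and3P[Ev' ne /eqP eq]]]; exists v'.
(* [gain] says nothing about the trace that forgets everything on [S2]; it is dropped, and [u0]
   shows that another one remains. *)
pose w0 : {ffun H -> option (option A)} := [ffun h => if h \in S2 then Some None else None].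
pose G := E2 :\ w0.
have goodP (u : {ffun H -> A}) : trace k S2 u != w0 -> exists2 h, h \in S2 & k (u h) != None.
  move=> ne_w0; apply/exists_inP; apply: contraNT ne_w0 => /exists_inPn none.
  apply/eqP/ffunP=> h; rewrite !ffunE; case: ifP => // hS.
  by have := none h hS; rewrite negbK => /eqP ->.
have G_gt0 : 0 < #|G|.
  apply/card_gt0P; exists (trace k S2 u0); rewrite !inE imset_f // andbT.
  apply: contraNneq u0h0 => /ffunP/(_ h0); rewrite !ffunE h0S.
  by case: (k _).
have le_G : #|E2| <= #|G| + 1.
  by rewrite (cardsD1 w0 E2) addnC leq_add2l leq_b1.
pose sgT (w : {ffun H -> option (option A)}) : {ffun H -> option (option A)} :=
  [ffun h => omap sg (w h)].
have sG : G \subset (restrict S2 @: D) :|: (sgT @: (restrict S2 @: D)).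
  apply/subsetP=> w; rewrite in_setD1 => /andP[ne_w /imsetP[u Xu ew]].
  rewrite ew in ne_w *; have [h hS uh] := goodP _ ne_w.
  have [z [z' [Xz Xz' eq1 [h' h'S ne] zu]]] := gain u h Xu hS uh.
  have Dz : trace k S z \in D.
    rewrite inE imset_f //=; apply/existsP; exists (trace k S z'); rewrite imset_f //=.
    rewrite !restrict_trace //; apply/andP; split; last first.
      by apply/trace_eqP => h1 /eq1 ->.
    apply: contraNN ne => /trace_eqP e; rewrite eq_sym; apply/eqP; apply: e.
    exact: (subsetP sS2).
  have D2z : trace k S2 z \in restrict S2 @: D.
    by rewrite -(restrict_trace k z sS2) imset_f.
  rewrite inE; case: zu => zu.
    by rewrite (_ : trace k S2 u = trace k S2 z) ?D2z //; apply/eqP/trace_eqP.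
  apply/orP; right; rewrite (_ : trace k S2 u = sgT (trace k S2 z)) ?imset_f //.
  by apply/ffunP=> h1; rewrite !ffunE; case: ifP => // /zu ->.
(* Origin of the 8: [#|E2| <= #|G| + 1 <= 2 * #|G| <= 4 * #|D|], and [#|D|] is at most twice the
   excess of [ntraces k S] over [ntraces k S1]. *)
have := subset_leq_card sG; have := (leq_card_setU (restrict S2 @: D) (sgT @: (restrict S2 @: D))).1.
have := leq_imset_card (restrict S2) D; have := leq_imset_card sgT (restrict S2 @: D).
have -> : ntraces k S2 = #|E2| by [].
by move=> *; lia.
Qed.

Definition weight (S : {set H}) := \prod_(k : {ffun A -> option A}) ntraces k S.

Lemma weight_sub (S S' : {set H}) : S' \subset S -> weight S' <= weight S.
Proof. by move=> sS'; apply: leq_prod => k _; apply: ntraces_sub. Qed.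

Lemma weight_le S : weight S <= #|XX| ^ #|{ffun A -> option A}|.
Proof.
rewrite -prod_nat_const; apply: leq_prod => k _; exact: ntraces_le.
Qed.

Lemma weight_gap k (S S1 S2 : {set H}) : S1 \subset S -> S2 \subset S ->
  8 * ntraces k S1 + ntraces k S2 <= 8 * ntraces k S ->
  8 * weight S1 + weight S2 <= 8 * weight S.
Proof.
move=> sS1 sS2 gap; apply: (prod_gap (i0 := [ffun v => k v])) => [k'|k'|].
- exact: ntraces_sub.
- exact: ntraces_sub.
by rewrite (_ : fun_of_fin _ = k) //; apply/funext=> v; rewrite ffunE.
Qed.

Definition piece (J : finType) (key : H -> J) (S : {set H}) j := [set h in S | key h == j].

Definition gap_splitting (J : finType) (S : {set H}) h1 h2 :=
  exists key : H -> J, key h1 != key h2 /\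
    forall i1 i2, i1 \in S -> i2 \in S -> key i1 != key i2 ->
      exists k : A -> option A,
        8 * ntraces k (piece key S (key i1)) + ntraces k (piece key S (key i2))
          <= 8 * ntraces k S.

Lemma weight_gt0 S : XX != set0 -> 0 < weight S.
Proof. by move=> X0; apply: prodn_gt0 => k; rewrite card_gt0 imset_eq0. Qed.

(** Induction on [#|S|]: the pieces are proper subsets because [key] separates [h1] from [h2], and
    by [sum_expn_gap] the powers of their weights add up to at most that of [S]. *)
Lemma card_le_weight (J : finType) : XX != set0 ->
  (forall (S : {set H}) h1 h2, h1 \in S -> h2 \in S -> h1 != h2 -> gap_splitting J S h1 h2) ->
  forall S : {set H}, #|S| <= weight S ^ (8 * #|J|).
Proof.
move=> X0 split S; have [n le_n] := ubnP #|S|; elim: n => // n IHn in S le_n *.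
have [|] := leqP #|S| 1.
  by move=> le1; apply: leq_trans le1 _; rewrite expn_gt0 weight_gt0.
case/card_gt1P=> h1 [h2 [h1S h2S ne_h]].
have [key [ne_key gap]] := split S h1 h2 h1S h2S ne_h.
(* An empty piece has positive weight but no gap condition, so it has to count as 0. *)
pose q j := if piece key S j == set0 then 0 else weight (piece key S j).
have sP j : piece key S j \subset S by apply/subsetP=> h; rewrite inE => /andP[].
have q_le j : q j <= weight S by rewrite /q; case: ifP => // _; apply: weight_sub.
have P0 j : piece key S j != set0 -> exists2 h, h \in S & key h = j.
  by case/set0Pn=> h; rewrite inE => /andP[hS /eqP <-]; exists h.
apply: leq_trans (sum_expn_gap q_le _).
  have -> : #|S| = \sum_j #|piece key S j|.
    rewrite -sum1_card (partition_big key predT) //=; apply: eq_bigr => j _.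
    by rewrite sum1_card; apply: eq_card => h; rewrite !inE.
  apply: leq_sum => j _; rewrite /q; case: eqP => [->|_]; first by rewrite cards0.
  apply: IHn; rewrite -ltnS; apply: leq_trans le_n; rewrite ltnS.
  apply: proper_card; rewrite properE sP; apply/subsetPn.
  have [e1 | ne1] := eqVneq (key h1) j; last by exists h1 => //; rewrite inE (negPf ne1) andbF.
  by exists h2 => //; rewrite inE -e1 eq_sym (negPf ne_key) andbF.
move=> j j' ne_j; rewrite {1 2}/q.
have [_|/P0[i1 i1S e1]] := boolP (piece key S j == set0).
  by rewrite muln0 add0n; apply: leq_trans (q_le j') _; apply: leq_pmull.
have [_|/P0[i2 i2S e2]] := boolP (piece key S j' == set0).
  by rewrite addn0 leq_mul2l weight_sub.
have [|k gk] := gap i1 i2 i1S i2S; first by rewrite e1 e2.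
by rewrite e1 e2 in gk; apply: weight_gap gk.
Qed.

End Counting.

(** * Splittings *)

Section Splitting.
Variables (F : Type) (ar : F -> nat) (A : algebra ar) (H : finType).
Variable XX : {set {ffun H -> A}}.
Hypothesis XX_const : forall a, [ffun=> a] \in XX.
Hypothesis XX_op : forall f (us : 'I_(ar f) -> {ffun H -> A}),
  (forall i, us i \in XX) -> [ffun h => op A f (fun i => us i h)] \in XX.

Lemma XX_ext (u v : {ffun H -> A}) : v \in XX -> u =1 v -> u \in XX.
Proof. by move=> Xv /ffunP ->. Qed.

Lemma XX_pol (V : Type) (p : (V -> A) -> A) (us : V -> {ffun H -> A}) :
  polynomial p -> (forall v, us v \in XX) -> [ffun h => p (fun v => us v h)] \in XX.
Proof.
move=> pP Xus; elim: pP => {p} [v | s | f ts _ IHts].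
- by apply: XX_ext (Xus v) _ => h; rewrite ffunE.
- exact: XX_const.
apply: XX_ext (XX_op (us := fun i => [ffun h => ts i (us^~ h)]) IHts) _ => h.
rewrite !ffunE; by congr (op A f _); apply/funext=> i; rewrite ffunE.
Qed.

Lemma XX_upol (p : A -> A) (u : {ffun H -> A}) :
  upol p -> u \in XX -> [ffun h => p (u h)] \in XX.
Proof. by move=> pP Xu; apply: (XX_pol (us := fun=> u) pP). Qed.

Lemma XX_bpol (f : A -> A -> A) (x u : {ffun H -> A}) :
  bpol f -> x \in XX -> u \in XX -> [ffun h => f (x h) (u h)] \in XX.
Proof.
move=> fP Xx Xu.
by apply: (XX_pol (us := fun b : bool => if b then x else u) fP); case.
Qed.

Variables (e : A -> A) (c d : A).
Hypothesis ms : minimal_set e c d.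

Local Notation N := #|A|`!.

Lemma N_gt0 : 0 < N. Proof. exact: fact_gt0. Qed.

Section Power.
Variable p : A -> A.
Hypotheses (pe : forall u, p (e u) = p u) (ep : forall u, e (p u) = p u).

Lemma e_iter n u : e u = u -> e (iter n p u) = iter n p u.
Proof. by case: n => [|n] //= _; rewrite ep. Qed.

Lemma iter_e n u : 0 < n -> iter n p (e u) = iter n p u.
Proof. by case: n => // n _; rewrite !iterSr pe. Qed.

(** On the minimal set the iterate is idempotent and injective, hence the identity. *)
Lemma iter_inj_ms u : inj_ms e p -> iter N p u = e u.
Proof.
move=> injp; have eN v : e (iter N p v) = iter N p v.
  by rewrite -(prednK N_gt0) /= ep.
have inj_iter n v v' : e v = v -> e v' = v' -> iter n p v = iter n p v' -> v = v'.
  elim: n => // n IHn ev ev' /injp; rewrite !e_iter //; exact: IHn.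
apply: (inj_iter N); rewrite ?eN ?(ms_idem ms) //.
by rewrite iter_e ?N_gt0 ?iter_fact_idem.
Qed.

End Power.

Let J := option {ffun A -> A}.

(** * Splitting according to permutations of the minimal set *)

Section Permutations.
Variable f : A -> A -> A.
Hypothesis fP : into_ms e f.

Let fe x u : f x (e u) = f x u. Proof. by case: fP. Qed.
Let ef x u : e (f x u) = f x u. Proof. by case: fP. Qed.

Definition perm_key s : J := if `[< inj_ms e (f s) >] then Some [ffun u => f s u] else None.

Lemma perm_key_eq s s' : inj_ms e (f s) -> perm_key s' = perm_key s -> f s' =1 f s.
Proof.
move=> inj_s; rewrite /perm_key (asboolT inj_s).
by case: ifP => // _ [/ffunP es] u; have := es u; rewrite !ffunE.
Qed.

(* [quot s s'] is the permutation f(s)^-1 f(s') of the minimal set. *)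
Definition quot s s' u := iter N.-1 (f s) (f s' u).

Lemma f_quot s s' u : inj_ms e (f s) -> f s (quot s s' u) = f s' u.
Proof.
by move=> inj_s; rewrite /quot -iterS (prednK N_gt0) (iter_inj_ms (fe s) (ef s)).
Qed.

Lemma e_quot s s' u : e (quot s s' u) = quot s s' u.
Proof. exact: e_iter. Qed.

Lemma quot_e s s' u : quot s s' (e u) = quot s s' u.
Proof. by rewrite /quot fe. Qed.

Lemma quotss s u : inj_ms e (f s) -> quot s s u = e u.
Proof.
by move=> inj_s; rewrite /quot -iterSr (prednK N_gt0) (iter_inj_ms (fe s) (ef s)).
Qed.

Lemma quot_inj s s' : inj_ms e (f s) -> inj_ms e (f s') -> inj_ms e (quot s s').
Proof. by move=> inj_s inj_s' u u' eq_q; apply: inj_s'; rewrite -(f_quot s' u inj_s) eq_q f_quot. Qed.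

Lemma quot_upol s s' : upol (quot s s').
Proof.
have [fb _ _] := fP.
by apply: (pol_upol (p := iter N.-1 (f s)) (upol_iter _ (bpol_fix s fb)) (bpol_fix s' fb)).
Qed.

Lemma quot_moves s s' : inj_ms e (f s) -> perm_key s != perm_key s' -> inj_ms e (f s') ->
  exists u, quot s s' (e u) != e u.
Proof.
move=> inj_s ne inj_s'; apply: contrapT => none; case/negP: ne; apply/eqP.
rewrite /perm_key !asboolT //; congr Some; apply/ffunP=> u; rewrite !ffunE.
rewrite -(f_quot s' u inj_s) -(fe s) -(fe s) -quot_e.
by have [->|ne] := eqVneq (quot s s' (e u)) (e u); rewrite ?(ms_idem ms) //; case: none; exists u.
Qed.

Definition moved (t : A -> A) v := if t (e v) == e v then None else Some (e v).

(** The identity on the minimal set when [f x] permutes it, and otherwise constant on the classes of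
    [Cg c d]. *)
Definition retr x u := iter N (f x) u.

Lemma retr_inj x u : inj_ms e (f x) -> retr x u = e u.
Proof. exact: iter_inj_ms. Qed.

Lemma retr_ninj x u u' : ~ inj_ms e (f x) -> Cg c d u u' -> retr x u = retr x u'.
Proof.
move=> ninj uu'; rewrite /retr -(prednK N_gt0) !iterSr; congr iter.
have [fb _ _] := fP.
exact: (not_inj_ms ms (bpol_fix x fb) (fe x) (ef x) ninj).
Qed.

Lemma e_retr x u : e (retr x u) = retr x u.
Proof. by rewrite /retr -(prednK N_gt0) /= ef. Qed.

Lemma retr_e x u : retr x (e u) = retr x u.
Proof. by apply: iter_e => //; apply: N_gt0. Qed.

Lemma retr_bpol : bpol retr. Proof. by apply: bpol_iter; case: fP. Qed.

Variables (S : {set H}) (x : {ffun H -> A}).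
Hypothesis Xx : x \in XX.

Let key h := perm_key (x h).

(** An evaluation [u] is paired with its image under the inverse of [f s] after [f (x h)]. On the
    first piece [f (x h)] is [f s] and the two agree up to [e]; on the second they differ wherever
    [quot s s'] displaces [u h]. *)
Lemma perm_gap_perm i1 i2 : i1 \in S -> i2 \in S -> key i1 != key i2 ->
  inj_ms e (f (x i1)) -> inj_ms e (f (x i2)) ->
  exists k : A -> option A,
    8 * ntraces XX k (piece key S (key i1)) + ntraces XX k (piece key S (key i2))
      <= 8 * ntraces XX k S.
Proof.
move=> i1S i2S ne_i inj1 inj2.
set s := x i1 in inj1; set s' := x i2 in inj2.
have [v0 v0P] := quot_moves inj1 ne_i inj2.
exists (moved (quot s s')).
apply: (ntraces_gap (sg := id) (u0 := [ffun=> v0])) => //.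
- by apply/subsetP=> h; rewrite inE => /andP[].
- by apply/subsetP=> h; rewrite inE => /andP[].
- by exists i2; rewrite ?inE ?i2S ?eqxx // ffunE /moved (negPf v0P).
move=> u h Xu; rewrite inE => /andP[hS /eqP kh] uh.
exists u, [ffun h => iter N.-1 (f s) (f (x h) (u h))]; split=> //.
- have [fb _ _] := fP.
  have q0 := upol_iter N.-1 (bpol_fix s fb).
  by apply: (XX_bpol (f := fun a b => iter N.-1 (f s) (f a b)) (pol_upol q0 fb)).
- move=> h'; rewrite inE ffunE => /andP[_ /eqP kh'].
  rewrite (perm_key_eq inj1 kh') -/(quot s s (u h')) quotss //.
  by rewrite /moved (ms_idem ms).
- exists h; first by rewrite inE hS kh eqxx.
  rewrite ffunE (perm_key_eq inj2 kh) -/(quot s s' (u h)).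
  move: uh; rewrite /moved e_quot quot_e.
  case: (eqVneq (quot s s' (u h)) (e (u h))) => // ne _; case: ifP => //= _.
  by apply: contraNneq ne => -[->].
by left.
Qed.

Section Mixed.
(* [t] is a permutation of the minimal set moving every point inside its class. *)
Variables (a b : A).
Hypotheses (inja : inj_ms e (f a)) (injb : inj_ms e (f b)).
Hypotheses (Cab : Cg c d a b) (ne_ab : perm_key b != perm_key a).
Let t := quot b a.

Let t_e u : t (e u) = t u. Proof. exact: quot_e. Qed.

Let Ct u : Cg c d (e u) (t u).
Proof.
rewrite -(quotss u injb) /t /quot; have [fb _ _] := fP.
apply: Cg_upol (upol_iter _ (bpol_fix b fb)) _.
by apply: Cg_bpol => //; [rewrite Cg_sym | apply: Cg_refl].
Qed.

Let retr_t y u : ~ inj_ms e (f y) -> retr y (t u) = retr y u.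
Proof. by move=> ninj; rewrite -(retr_e y u); apply: retr_ninj => //; rewrite Cg_sym. Qed.

Let t_iter u : iter N t u = e u.
Proof.
by apply: (iter_inj_ms t_e (e_quot b a)); apply: quot_inj.
Qed.

Let tt_neq u : t (e u) != e u -> t (t u) != t u.
Proof.
move=> ne; apply: contraNneq ne => /(quot_inj injb inja).
by rewrite /t e_quot quot_e => ->.
Qed.

Let moved_t u : moved t (t u) = if t (e u) == e u then None else Some (t u).
Proof.
rewrite /moved e_quot -/t -/(t u); case: (eqVneq (t (e u)) (e u)) => [eq|/tt_neq/negPf-> //].
have tu : t u = e u by rewrite -eq /t quot_e.
by rewrite tu eq eqxx.
Qed.

Let moved_ret u : moved t u = omap (iter N.-1 t) (moved t (t u)).
Proof.
rewrite moved_t /moved; case: ifP => //= _; congr Some.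
by rewrite -iterSr (prednK N_gt0) t_iter.
Qed.

Let moved_retr y u : moved t (retr y u) = moved t u -> moved t u != None -> retr y u = e u.
Proof. by rewrite /moved e_retr; do 2!case: ifP => // _; case. Qed.

Let good0 : exists v, moved t v != None.
Proof.
have [v ne] := quot_moves injb ne_ab inja.
by exists v; rewrite /moved (negPf ne).
Qed.

(** On the permutation piece [retr (x h)] acts as [e] and tells [u] from [t u] where [t] moves
    [u h]; on the other piece it identifies them. Each order of the pieces needs its own pair of
    evaluations. *)
Lemma mixed_gap i1 i2 : i1 \in S -> i2 \in S ->
  inj_ms e (f (x i1)) -> ~ inj_ms e (f (x i2)) ->
  8 * ntraces XX (moved t) (piece key S (key i1)) +
    ntraces XX (moved t) (piece key S (key i2)) <= 8 * ntraces XX (moved t) S /\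
  8 * ntraces XX (moved t) (piece key S (key i2)) +
    ntraces XX (moved t) (piece key S (key i1)) <= 8 * ntraces XX (moved t) S.
Proof.
move=> i1S i2S inj1 ninj2.
have perm h : h \in piece key S (key i1) -> inj_ms e (f (x h)).
  rewrite inE => /andP[_ /eqP]; rewrite /key {2}/perm_key (asboolT inj1).
  by rewrite /perm_key; case: asboolP.
have nonperm h : h \in piece key S (key i2) -> ~ inj_ms e (f (x h)).
  rewrite inE => /andP[_ /eqP]; rewrite /key {2}/perm_key (asboolF ninj2).
  by rewrite /perm_key; case: asboolP.
have Xt u : u \in XX -> [ffun h => t (u h)] \in XX by apply/XX_upol/quot_upol.
have Xr u : u \in XX -> [ffun h => retr (x h) (u h)] \in XX by apply: (XX_bpol retr_bpol Xx).
have [v0 v0P] := good0.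
split.
  apply: (ntraces_gap (sg := omap (iter N.-1 t)) (u0 := [ffun=> v0])) => //.
  - by apply/subsetP=> h; rewrite inE => /andP[].
  - by apply/subsetP=> h; rewrite inE => /andP[].
  - by exists i2; rewrite ?inE ?i2S ?eqxx // ffunE.
  move=> u h Xu hS2 uh.
  (* If [retr] changes the measured value of [u h], it is compared with [u]. Otherwise [t u] is
     compared with its retraction, which at [h] is [e (u h)]; then [iter N.-1 t], the inverse of
     [t], recovers [u] from [t u]. *)
  have [ch|nch] := eqVneq (moved t (retr (x h) (u h))) (moved t (u h)); last first.
    exists u, [ffun h => retr (x h) (u h)]; split=> //; [exact: Xr | | | by left].
      by move=> h' /perm injh'; rewrite ffunE retr_inj // /moved (ms_idem ms).
    by exists h => //; rewrite ffunE eq_sym.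
  exists [ffun h => t (u h)], [ffun h => retr (x h) (t (u h))]; split.
  - exact: Xt.
  - by apply: XX_ext (Xr _ (Xt _ Xu)) _ => h'; rewrite !ffunE.
  - by move=> h' /perm injh'; rewrite !ffunE retr_inj // /moved (ms_idem ms).
  - exists h => //; rewrite !ffunE retr_t; last exact: nonperm.
    have eqr := moved_retr ch uh; rewrite ch moved_t; move: uh; rewrite /moved.
    rewrite t_e; case: (eqVneq (t (u h)) (e (u h))) => [_|ne _]; first by rewrite eqxx.
    by apply: contraNneq ne => -[->].
  - by right=> h' _; rewrite ffunE.
apply: (ntraces_gap (sg := id) (u0 := [ffun=> v0])) => //.
- by apply/subsetP=> h; rewrite inE => /andP[].
- by apply/subsetP=> h; rewrite inE => /andP[].
- by exists i1; rewrite ?inE ?i1S ?eqxx // ffunE.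
move=> u h Xu hS2 uh.
exists [ffun h => retr (x h) (u h)], [ffun h => retr (x h) (t (u h))]; split.
- exact: Xr.
- by apply: XX_ext (Xr _ (Xt _ Xu)) _ => h'; rewrite !ffunE.
- by move=> h' /nonperm ninj; rewrite !ffunE retr_t.
- exists h => //; rewrite !ffunE !retr_inj; try exact: perm.
  rewrite /t e_quot -/t moved_t; move: uh; rewrite /moved (ms_idem ms).
  rewrite t_e; case: (eqVneq (t (u h)) (e (u h))) => [_|ne _]; first by rewrite eqxx.
  by apply: contraNneq ne => -[->].
by left=> h' /perm injh'; rewrite ffunE retr_inj // /moved (ms_idem ms).
Qed.

End Mixed.

Lemma perm_splitting a b h1 h2 :
  inj_ms e (f a) -> inj_ms e (f b) -> Cg c d a b -> perm_key b != perm_key a ->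
  key h1 != key h2 -> gap_splitting XX J S h1 h2.
Proof.
move=> inja injb Cab ne_ab ne_h; exists key; split=> // i1 i2 i1S i2S ne_i.
have [inj1|ninj1] := pselect (inj_ms e (f (x i1)));
  have [inj2|ninj2] := pselect (inj_ms e (f (x i2))).
- exact: perm_gap_perm.
- by exists (moved (quot b a)); have [] := mixed_gap inja injb Cab ne_ab i1S i2S inj1 ninj2.
- by exists (moved (quot b a)); have [] := mixed_gap inja injb Cab ne_ab i2S i1S inj2 ninj1.
by case/eqP: ne_i; rewrite /key /perm_key !asboolF.
Qed.

End Permutations.

(** * Splitting by a meet operation *)

Section Meet.
Variables (g : A -> A -> A) (one zero : A).
Hypothesis gP : into_ms e g.
Hypothesis g_idem : forall s u, g s (g s u) = g s u.
Hypotheses (e1 : e one = one) (e0 : e zero = zero) (ne10 : one != zero).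
Hypotheses (C10 : Cg c d one zero) (g1 : forall u, g one u = e u) (g01 : g zero one = zero).

(** The map sending [s] to [g (e s) one] separates [one] from [zero], so it is injective on the
    minimal set. If [g (e s) v = one], idempotence gives [g (e s) one = one = g one one]. *)
Lemma g_one s v : g (e s) v = one -> e s = one.
Proof.
have [gb ge eg] := gP.
have injL : inj_ms e (fun s => g (e s) one).
  apply: (inj_ms_sep ms _ _ _ C10) => [|u|u|]; rewrite ?(ms_idem ms) ?eg //.
    by apply: (pol_bpol gb (ms_pol ms) (pol_const one)).
  by rewrite e1 e0 g1 g01 e1.
by move=> gsv; rewrite -[RHS]e1; apply: injL; rewrite e1 g1 e1 -{1}gsv g_idem.
Qed.

(** Applying [g (e (x h))] does nothing where [e (x h)] is [one] and never yields [one] elsewhere.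
    Measured by equality with [one], [u] and its image can differ only where [e (x h)] is not [one],
    the image and the constant [zero] only where it is. *)
Lemma meet_splitting (S : {set H}) (x : {ffun H -> A}) h1 h2 : x \in XX ->
  (e (x h1) == one) != (e (x h2) == one) -> gap_splitting XX J S h1 h2.
Proof.
move=> Xx ne_h; have [gb ge eg] := gP.
have ne01 : (zero == one) = false by rewrite eq_sym (negPf ne10).
pose key h : J := if e (x h) == one then None else Some [ffun v => v].
exists key; split; first by rewrite /key; move: ne_h; do 2!case: (_ == one).
have Xe : [ffun h => e (x h)] \in XX by apply: XX_upol (ms_pol ms) Xx.
have Xg (u : {ffun H -> A}) : u \in XX -> [ffun h => g (e (x h)) (u h)] \in XX.
  by move=> Xu; apply: XX_ext (XX_bpol gb Xe Xu) _ => h; rewrite !ffunE.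
pose k v := if e v == one then Some one else None.
have kg s v : e s != one -> k (g (e s) v) = None.
  by move=> nes; rewrite /k eg; case: eqP => // /g_one/eqP; rewrite (negPf nes).
move=> i1 i2 i1S i2S ne_i; exists k.
have keyP h i : h \in piece key S (key i) -> (e (x h) == one) = (e (x i) == one).
  by rewrite inE => /andP[_]; rewrite /key; case: (e (x h) == _); case: (e (x i) == _).
apply: (ntraces_gap (sg := id) (u0 := [ffun=> one])) => //.
- by apply/subsetP=> h; rewrite inE => /andP[].
- by apply/subsetP=> h; rewrite inE => /andP[].
- by exists i2; rewrite ?inE ?i2S ?eqxx // ffunE /k e1 eqxx.
move=> u h Xu hS2 uh; have /keyP kh := hS2.
have [ei1|ei1] := eqVneq (e (x i1)) one.
  have nei2 : e (x i2) != one.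
    by apply: contraNneq ne_i => ei2; rewrite /key ei1 ei2.
  exists u, [ffun h => g (e (x h)) (u h)]; split=> //; [exact: Xg | | | by left].
    move=> h' /keyP; rewrite ei1 eqxx ffunE => /eqP ->.
    by rewrite g1 /k (ms_idem ms).
  by exists h => //; rewrite ffunE kg // kh.
have ei2 : e (x i2) == one.
  by apply: contraNT ne_i => nei2; rewrite /key (negPf ei1) (negPf nei2).
rewrite ei2 in kh.
exists [ffun h => g (e (x h)) (u h)], [ffun=> zero]; split=> //; first exact: Xg.
- move=> h' /keyP; rewrite (negPf ei1) !ffunE => ne_h'.
  by rewrite kg ?ne_h' // /k e0 ne01.
- exists h => //; rewrite !ffunE (eqP kh) g1 /k (ms_idem ms) e0 ne01.
  by move: uh; rewrite /k; case: ifP.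
left=> h' /keyP; rewrite ei2 ffunE => /eqP ->.
by rewrite g1 /k (ms_idem ms).
Qed.

End Meet.

End Splitting.

(** * Existence of a splitting *)

Definition no_sa_congruence (F : Type) (ar : F -> nat) (A : algebra ar) :=
  forall alpha : A -> A -> Prop,
    congruence alpha -> strongly_abelian alpha -> ~ nontrivial_rel alpha.

Lemma splitting_exists (F : Type) (ar : F -> nat) (A : algebra ar) (H : finType)
    (XX : {set {ffun H -> A}}) (S : {set H}) h1 h2 (u : {ffun H -> A}) :
  (forall a, [ffun=> a] \in XX) ->
  (forall f (us : 'I_(ar f) -> {ffun H -> A}),
     (forall i, us i \in XX) -> [ffun h => op A f (fun i => us i h)] \in XX) ->
  no_sa_congruence A -> u \in XX -> u h1 != u h2 ->
  gap_splitting XX (option {ffun A -> A}) S h1 h2.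
Proof.
move=> Xc Xo noSA Xu ne_u.
have [e [c [d [ms sub]]]] := minimal_set_exists ne_u.
(* Pairs in [Cg c d] lie in the congruence generated by [(u h1, u h2)], so a property distinguishing
   such a pair distinguishes [h1] from [h2] through a polynomial image of [u]. *)
have point (Q : pred A) s s' : Cg c d s s' -> Q s -> ~~ Q s' ->
    exists2 x, x \in XX & Q (x h1) != Q (x h2).
  move=> /(Cg_min sub) ss' Qs Qs'; have [p pP neQ] := Cg_cross ss' Qs Qs'.
  by exists [ffun h => p (u h)]; [apply: XX_upol | rewrite !ffunE].
have permc f a b : into_ms e f -> Cg c d a b -> inj_ms e (f a) -> inj_ms e (f b) ->
    ~ f b =1 f a -> gap_splitting XX (option {ffun A -> A}) S h1 h2.
  move=> fP Cab inja injb ne_f.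
  have ne_k : perm_key e f b != perm_key e f a.
    by apply/eqP => /(perm_key_eq inja).
  have [|x Xx ne_x] := point (fun s => perm_key e f s == perm_key e f a) _ _ Cab (eqxx _).
    exact: ne_k.
  apply: (perm_splitting Xc Xo ms fP S Xx inja injb Cab ne_k).
  by apply: contraNneq ne_x => ->.
have meetc g one zero : into_ms e g -> (forall s u, g s (g s u) = g s u) ->
    e one = one -> e zero = zero -> one != zero -> Cg c d one zero ->
    (forall u, g one u = e u) -> g zero one = zero ->
    gap_splitting XX (option {ffun A -> A}) S h1 h2.
  move=> gP g_idem e1 e0 ne C10 g1 g01.
  have Q1 : e one == one by rewrite e1.
  have Q0 : e zero != one by rewrite e0 eq_sym.
  have [x Xx ne_x] := point (fun s => e s == one) _ _ C10 Q1 Q0.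
  exact: (meet_splitting Xc Xo ms gP g_idem e1 e0 ne C10 g1 g01 S Xx ne_x).
(* As [g b] collapses classes, [g b a = g b b]. If this value is [b] or [a], a meet operation arises
   on these two points; otherwise the right translations by [a] and by [b] permute the minimal set,
   and they differ at [a]. *)
have collapse g a b : into_ms e g -> (forall s u, g s (g s u) = g s u) ->
    e a = a -> e b = b -> Cg c d a b -> (forall u, g a u = e u) ->
    ~ inj_ms e (g b) -> gap_splitting XX (option {ffun A -> A}) S h1 h2.
  move=> gP g_idem ea eb Cab ga ninj; have [gb ge eg] := gP.
  have ne_ab : a != b.
    apply: contra_notN ninj => /eqP <- v v'; by rewrite !ga.
  have gbab : g b a = g b b by apply: (not_inj_ms ms (bpol_fix b gb) (ge b) (eg b) ninj).
  have LP v : upol (fun x => g (e x) v).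
    by apply: (pol_bpol gb (ms_pol ms) (pol_const v)).
  have injL v : g a v != g b v -> inj_ms e (fun x => g (e x) v).
    move=> ne; apply: (inj_ms_sep ms (LP v) _ _ Cab) => [x|x|]; rewrite ?(ms_idem ms) ?eg //.
    by rewrite ea eb.
  have [wb|ne_wb] := eqVneq (g b a) b.
    exact: (meetc g a b gP g_idem ea eb ne_ab Cab ga wb).
  have injLb : inj_ms e (fun x => g (e x) b).
    by apply: injL; rewrite ga eb -gbab eq_sym.
  have [wa|ne_wa] := eqVneq (g b a) a.
    (* [x |-> g x b] exchanges [a] and [b] *)
    pose g' x v := g (g (e x) b) v.
    have ne_ba : b != a by rewrite eq_sym.
    have Cba : Cg c d b a by rewrite Cg_sym.
    apply: (meetc g' b a) => //.
    - split=> [|x v|x v]; rewrite /g' ?ge ?eg //.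
      exact: (pol_bpol gb (pol_upol (LP b) (pol_var true)) (pol_var false)).
    - by move=> s v; rewrite /g' g_idem.
    - by move=> v; rewrite /g' eb -gbab wa ga.
    - by rewrite /g' ea ga eb -gbab.
  have injLa : inj_ms e (fun x => g (e x) a).
    by apply: injL; rewrite ga ea eq_sym.
  apply: (permc (fun v x => g (e x) v) a b) => //.
    split=> [|v x|v x]; rewrite ?(ms_idem ms) ?eg //.
    exact: (pol_bpol gb (pol_upol (ms_pol ms) (pol_var false)) (pol_var true)).
  by move=> /(_ a)/eqP; rewrite ea !ga ea eb eq_sym (negPf ne_ab).
have [rigid|] := pselect (forall f, into_ms e f ->
    forall a b, Cg c d a b -> inj_ms e (f a) -> f b =1 f a).
  case: (noSA _ (Cg_congruence c d) (strongly_abelian_Cg ms rigid)).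
  by exists c, d; split; [apply/eqP/(ms_neq ms) | exact: Cg_gen].
case/existsNP=> f /not_implyP[fP /existsNP[a /existsNP[b /not_implyP[Cab /not_implyP[inja ne_f]]]]].
have [injb|ninjb] := pselect (inj_ms e (f b)); first exact: permc ne_f.
(* [collapse] needs parameters fixed by [e]. The pair is therefore replaced by [p c] and [p d], just
   one of which gives a permutation, and [c] and [d] become the parameters. *)
have [||p pP] := Cg_cross (Q := fun s => `[< inj_ms e (f s) >]) Cab.
- exact: asboolT.
- by rewrite asboolF.
pose g x := iter #|A|`! (f (p x)); have [fb fe ef] := fP.
have gP : into_ms e g.
  split=> [|x v|x v]; rewrite /g.
  - by apply: bpol_iter; apply: (pol_bpol fb (pol_upol pP (pol_var true)) (pol_var false)).
  - by apply: iter_e => //; apply: fact_gt0.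
  - by rewrite -(prednK (fact_gt0 _)) /= ef.
have g_idem s v : g s (g s v) = g s v by apply: iter_fact_idem.
have ginj s v : inj_ms e (f (p s)) -> g s v = e v.
  by apply: (iter_inj_ms ms (fe _) (ef _)).
have gninj s : ~ inj_ms e (f (p s)) -> ~ inj_ms e (g s).
  move=> ninj inj; apply: ninj => v v' eqf; apply: inj.
  by rewrite /g -(prednK (fact_gt0 _)) !iterSr eqf.
have [injc|ninjc] := pselect (inj_ms e (f (p c)));
  have [injd|ninjd] := pselect (inj_ms e (f (p d))).
- by rewrite !asboolT // eqxx.
- move=> _; apply: (collapse g c d gP g_idem (ms_c ms) (ms_d ms) (Cg_gen c d)) => [v|].
    exact: ginj.
  exact: gninj.
- move=> _; apply: (collapse g d c gP g_idem (ms_d ms) (ms_c ms)) => [|v|].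
  + by rewrite Cg_sym Cg_gen.
  + exact: ginj.
  exact: gninj.
by rewrite !asboolF // eqxx.
Qed.

(** For [n = #|A|], [8 * (n ^ n).+1] is the exponent of [card_le_weight] with keys in
    [option {ffun A -> A}], and [n.+1 ^ n] is the number of factors of [weight]. *)
Definition hom_exponent n := 8 * (n ^ n).+1 * n.+1 ^ n.

Lemma card_le_evaluations (F : Type) (ar : F -> nat) (A : algebra ar) (H : finType)
    (XX : {set {ffun H -> A}}) :
  XX != set0 ->
  (forall a, [ffun=> a] \in XX) ->
  (forall f (us : 'I_(ar f) -> {ffun H -> A}),
     (forall i, us i \in XX) -> [ffun h => op A f (fun i => us i h)] \in XX) ->
  (forall h1 h2, h1 != h2 -> exists2 u : {ffun H -> A}, u \in XX & u h1 != u h2) ->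
  no_sa_congruence A ->
  #|H| <= #|XX| ^ hom_exponent #|A|.
Proof.
move=> X0 Xc Xo sep noSA; rewrite -cardsT.
apply: leq_trans (card_le_weight (XX := XX) (J := option {ffun A -> A}) X0 _ _) _.
  move=> S h1 h2 _ _ /sep[u Xu ne_u]; exact: splitting_exists Xu ne_u.
apply: leq_trans (_ : (#|XX| ^ #|{ffun A -> option A}|) ^ (8 * #|{: option {ffun A -> A}}|) <= _).
  by rewrite leq_exp2r ?weight_le // muln_gt0 card_option.
by rewrite -expnM /hom_exponent card_option !card_ffun card_option mulnC.
Qed.

(** * The polynomial upper bound *)

Section UpperBound.
Variables (F : Type) (ar : F -> nat) (A X : algebra ar).

Lemma HomP (h : {ffun X -> A}) : reflect (is_hom h) (h \in Hom X A).
Proof. by rewrite inE; apply: asboolP. Qed.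

Lemma image_subuniverse (h : {ffun X -> A}) : h \in Hom X A -> subuniverse (h @: X).
Proof.
move=> /HomP hh f a ha.
have /choice[x ax] i : exists x, a i = h x by have /imsetP[x _] := ha i; exists x.
by rewrite (_ : a = fun i => h (x i)) -?hh ?imset_f //; apply/funext.
Qed.

Definition homs_with_section (B : {set A}) (s : A -> X) :=
  [set h : {ffun X -> A} | [&& h \in Hom X A, h @: X == B & [forall b in B, h (s b) == b]]].

(** [XX] consists of the evaluations at points of [X]. Cutting the codomain down to the image [B]
    and fixing the preimages [s b] puts all constants into [XX], as the evaluations at the [s b]. *)
Lemma card_homs_with_section (B : {set A}) (s : A -> X) :
  (forall HB : subuniverse B, no_sa_congruence (subalg HB)) -> 0 < #|X| ->
  #|homs_with_section B s| <= #|X| ^ hom_exponent #|B|.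
Proof.
move=> noSA X_gt0; set S := homs_with_section B s.
have [->|/set0Pn[h0]] := eqVneq S set0; first by rewrite cards0.
rewrite inE => /and3P[hom0 /eqP im0 _].
have HB : subuniverse B by rewrite -im0; apply: image_subuniverse.
have {}noSA := noSA HB.
have [x0 _] := card_gt0P X_gt0.
pose H : finType := {h | h \in S}.
have SP (h : H) : [/\ is_hom (val h), (forall x, val h x \in B) &
    forall b, b \in B -> val h (s b) = b].
  have := valP h; rewrite inE => /and3P[/HomP hh /eqP im /forall_inP sec].
  by split=> // [x|b /sec/eqP //]; rewrite -im imset_f.
have memB (h : H) x : val h x \in B by have [_ ->] := SP h.
pose ev (x : X) : {ffun H -> subalg HB} := [ffun h : H => exist _ (val h x) (memB h x)].
have evE (x : X) (h : H) : val (ev x h) = val h x by rewrite ffunE.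
pose XX := [set ev x | x : X].
have le_XX : #|XX| <= #|X| by apply: leq_imset_card.
have -> : #|S| = #|H| by rewrite card_sig; apply: eq_card => h; rewrite !inE.
have -> : #|B| = #|subalg HB| by rewrite card_sig; apply: eq_card => h; rewrite !inE.
apply: leq_trans (_ : #|XX| ^ hom_exponent #|subalg HB| <= _); last first.
  by case: hom_exponent => // n; rewrite leq_exp2r.
apply: card_le_evaluations noSA.
- by apply/set0Pn; exists (ev x0); apply: imset_f.
- move=> b; rewrite (_ : [ffun=> b] = ev (s (val b))) ?imset_f //.
  apply/ffunP=> h; rewrite ffunE; apply: val_inj; rewrite evE.
  by have [_ _ ->] := SP h; last exact: valP.
- move=> f us Xus.
  have /choice[xs xsE] i : exists x, us i = ev x by have /imsetP[x _] := Xus i; exists x.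
  rewrite (_ : [ffun h => _] = ev (op X f xs)) ?imset_f //.
  apply/ffunP=> h; rewrite ffunE; apply: val_inj; rewrite evE /=.
  have [-> _ _] := SP h; congr (op A f _); apply/funext=> i.
  by rewrite xsE evE.
move=> h1 h2 ne_h.
have /existsP[x ne_x] : [exists x, val h1 x != val h2 x].
  rewrite -negb_forall; apply: contra ne_h => /forallP e.
  by apply/eqP/val_inj/ffunP => x; apply/eqP/e.
exists (ev x); first exact: imset_f.
by apply: contraNneq ne_x => e; rewrite -!evE e.
Qed.

Lemma card_Hom_le :
  (forall (B : {set A}) (HB : subuniverse B), no_sa_congruence (subalg HB)) ->
  0 < #|X| ->
  #|Hom X A| <= 2 ^ #|A| * #|X| ^ (#|A| + \max_(B : {set A}) hom_exponent #|B|).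
Proof.
move=> noSA X_gt0; have [x0 _] := card_gt0P X_gt0.
(* The image together with a choice of preimages; [x0] is a dummy preimage outside the image. *)
pose key (h : {ffun X -> A}) :=
  (h @: X, [ffun b : A => odflt x0 [pick x | h x == b]] : {ffun A -> X}).
have -> : #|Hom X A| = \sum_p #|[set h in Hom X A | key h == p]|.
  rewrite -sum1_card (partition_big key predT) //=; apply: eq_bigr => j _.
  by rewrite -sum1_card; apply: eq_bigl => h; rewrite [RHS]inE.
set K := \max_B _; rewrite expnD mulnA.
apply: leq_trans (_ : \sum_(p : {set A} * {ffun A -> X})
    #|X| ^ K <= _); last first.
  by rewrite sum_nat_const card_prod card_ffun -(cardsT A) -card_powerset powersetT !cardsT.
apply: leq_sum => -[B s] _.
apply: leq_trans (_ : #|homs_with_section B s| <= _).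
  apply/subset_leq_card/subsetP=> h; rewrite !inE => /andP[-> /eqP[im sec]].
  rewrite im eqxx /=; apply/forall_inP=> b; rewrite -im => /imsetP[x _ eb].
  by rewrite -sec ffunE; case: pickP => //= none; have := none x; rewrite eb eqxx.
apply: leq_trans (card_homs_with_section _ (noSA B) X_gt0) _.
by apply: leq_pexp2l => //; apply: (leq_bigmax B).
Qed.

Lemma card_Hom_empty : #|X| = 0 -> #|Hom X A| <= 1.
Proof.
by move=> X0; apply: leq_trans (max_card _) _; rewrite card_ffun X0.
Qed.

End UpperBound.

Lemma polynomial_upper_bound (F : Type) (ar : F -> nat) (A : algebra ar) :
  (forall (B : {set A}) (HB : subuniverse B), no_sa_congruence (subalg HB)) ->
  exists k, cA_bigO_pow A k.
Proof.
move=> noSA; exists (#|A| + \max_(B : {set A}) hom_exponent #|B|).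
exists (2 ^ #|A|), 1 => n n_gt0 X le_n.
have [X0|X_gt0] := posnP #|X|.
  apply: leq_trans (card_Hom_empty _ X0) _.
  by rewrite muln_gt0 !expn_gt0 n_gt0.
apply: leq_trans (card_Hom_le noSA X_gt0) _.
rewrite leq_mul2l; apply/orP; right.
by case: (#|A| + _) => // k; rewrite leq_exp2r.
Qed.

(** * The lower bound *)

Lemma exp_dominates_pow c k n0 : exists2 m, n0 <= m & c * m.+1 ^ k < 2 ^ m.+1.
Proof.
(* With [m.+1 = s * k.+1], one factor [2 ^ s] of [2 ^ m.+1] exceeds [c * k.+1 ^ k], and the other
   [k] dominate [s ^ k]; the summand [n0] gives [n0 <= m]. *)
pose s := (c * k.+1 ^ k + n0).+1; pose m := (s * k.+1).-1.
have em : m.+1 = s * k.+1 by rewrite /m prednK // muln_gt0.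
exists m; first by have := leq_pmulr s (ltn0Sn k); lia.
rewrite em expnM expnSr expnMn mulnCA.
have lt_s : s ^ k <= (2 ^ s) ^ k.
  by case: (k) => // j; rewrite leq_exp2r //; apply/ltnW/ltn_expl.
apply: leq_ltn_trans (leq_mul lt_s (leqnn _)) _.
rewrite ltn_pmul2l ?expn_gt0 // (leq_trans _ (ltn_expl s _)) //.
by rewrite ltnS /s; lia.
Qed.

Section Rename.
Variables (F : Type) (ar : F -> nat).

Fixpoint rename k l (s : 'I_k -> 'I_l) (t : term ar k) : term ar l :=
  match t with
  | Var i => Var ar (s i)
  | App f ts => App (fun i => rename s (ts i))
  end.

Lemma eval_rename (A : algebra ar) k l (s : 'I_k -> 'I_l) t (v : 'I_l -> A) :
  eval_term (rename s t) v = eval_term t (fun i => v (s i)).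
Proof.
by elim: t => //= f ts IHts; congr (op A f _); apply/funext=> i; apply: IHts.
Qed.

(** The definition singles out the first variable; renaming by the involution [s], which exchanges
    it with [j], reaches every coordinate. *)
Lemma strongly_abelian_coord (A : algebra ar) (alpha : A -> A -> Prop) k
    (t : term ar k.+1) j (x y z : 'I_k.+1 -> A) :
  strongly_abelian alpha ->
  (forall i, alpha (x i) (y i)) -> (forall i, alpha (y i) (z i)) ->
  eval_term t x = eval_term t y ->
  eval_term t (upd z j (x j)) = eval_term t (upd z j (y j)).
Proof.
move=> sa xy yz eq_t.
pose s i := if i == ord0 then j else if i == j then ord0 else i.
have s0 : s ord0 = j by [].
have ss i : s (s i) = i.
  rewrite /s; case: (eqVneq i ord0) => [->|ne0]; first by rewrite eqxx; case: eqVneq.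
  by case: (eqVneq i j) => [->|/negPf ->]; rewrite ?eqxx ?(negPf ne0).
have s_eq0 i : (s i == ord0) = (i == j) by rewrite -(can_eq ss) ss s0.
have sC (v : 'I_k.+1 -> A) : (fun i => v (s (s i))) = v.
  by apply/funext=> i; rewrite ss.
have cloP : Clo (fun v : 'I_k.+1 -> A => eval_term (rename s t) v) by exists (rename s t).
have := sa k _ cloP (x \o s) (y \o s) (z \o s) (fun i => xy _) (fun i _ => yz _).
rewrite !eval_rename /= !sC s0 => /(_ eq_t).
have E c : (fun i => if s i == ord0 then c else z (s (s i))) = upd z j c.
  by apply/funext=> i; rewrite s_eq0 ss.
by rewrite !E.
Qed.

Lemma card_Hom_subalg (A X : algebra ar) (B : {set A}) (HB : subuniverse B) :
  #|Hom X (subalg HB)| <= #|Hom X A|.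
Proof.
pose c (h : {ffun X -> subalg HB}) : {ffun X -> A} := [ffun x => val (h x)].
have c_inj : injective c.
  move=> h h' /ffunP e; apply/ffunP=> x; apply: val_inj.
  by have := e x; rewrite !ffunE.
rewrite -(card_imset _ c_inj); apply/subset_leq_card/subsetP=> _ /imsetP[h /HomP hh ->].
apply/HomP => f xs; rewrite ffunE hh /=; congr (op A f _).
by apply/funext=> i; rewrite ffunE.
Qed.

End Rename.

Section LowerBound.
Variables (F : Type) (ar : F -> nat) (A : algebra ar) (alpha : A -> A -> Prop) (a b : A).
Hypotheses (alpha_congr : congruence alpha) (alpha_sa : strongly_abelian alpha).
Hypotheses (ab : alpha a b) (ne_ab : a <> b).
Variable m : nat.

Local Notation cube := {ffun 'I_m.+1 -> bool}.

Definition vertex (w : 'I_m.+1 -> bool) : 'I_m.+1 -> A := fun j => if w j then a else b.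

Definition term_fun (t : term ar m.+1) : {ffun cube -> A} :=
  [ffun w : cube => eval_term t (vertex w)].

Definition is_term_fun (g : {ffun cube -> A}) := `[< exists t, g = term_fun t >].

Lemma term_fun_op f (gs : 'I_(ar f) -> {g | is_term_fun g}) :
  is_term_fun [ffun w => op A f (fun i => val (gs i) w)].
Proof.
have /choice[ts tsE] i : exists t, val (gs i) = term_fun t by apply/asboolP/(valP (gs i)).
apply/asboolP; exists (App ts); apply/ffunP=> w; rewrite !ffunE /=.
by congr (op A f _); apply/funext=> i; rewrite tsE ffunE.
Qed.

(* The subalgebra of [A ^ cube] generated by the [m.+1] projections to [{a, b}]. *)
Definition cube_algebra : algebra ar :=
  @Algebra F ar {g | is_term_fun g} (fun f gs => exist is_term_fun _ (term_fun_op gs)).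

Lemma card_Hom_cube : 2 ^ m.+1 <= #|Hom cube_algebra A|.
Proof.
pose ev (w : cube) : {ffun cube_algebra -> A} := [ffun g : cube_algebra => sval g w].
have ev_inj : injective ev.
  move=> w w' /ffunP e; apply/ffunP=> j.
  have Pj : is_term_fun (term_fun (Var ar j)) by apply/asboolP; exists (Var ar j).
  have := e (exist is_term_fun _ Pj); rewrite !ffunE /= /vertex.
  by do 2!case: (_ j) => //; move/esym.
have -> : 2 ^ m.+1 = #|ev @: cube|.
  by rewrite card_imset // card_ffun card_bool card_ord.
apply/subset_leq_card/subsetP=> _ /imsetP[w _ ->]; apply/HomP => f gs.
by rewrite !ffunE; congr (op A f _); apply/funext=> i; rewrite ffunE.
Qed.

Definition flip (w : 'I_m.+1 -> bool) j v : cube := [ffun i => upd w j v i].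

Definition essential (g : {ffun cube -> A}) :=
  [set j | [exists w : cube, g (flip w j true) != g (flip w j false)]].

Lemma vertex_flip (w : cube) j v : vertex (flip w j v) = upd (vertex w) j (if v then a else b).
Proof. by apply/funext=> i; rewrite /vertex ffunE /upd; case: eqP. Qed.

(** If [w j] and [w' j] differed, strong abelianness would turn [g w = g w'] into equality of [g] on
    all pairs of vertices differing only at [j]. *)
Lemma essential_eq g (w w' : cube) j :
  is_term_fun g -> j \in essential g -> g w = g w' -> w j = w' j.
Proof.
case/asboolP=> t ->; rewrite inE => /existsP[w0 ne_w0]; rewrite !ffunE => eq_t.
have [refl sym _ _] := alpha_congr.
have alpha_vertex (u u' : cube) i : alpha (vertex u i) (vertex u' i).
  by rewrite /vertex; case: (u i); case: (u' i); auto.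
have := strongly_abelian_coord j alpha_sa (alpha_vertex w w') (alpha_vertex w' w0) eq_t.
rewrite {2 4}/vertex -!vertex_flip; move: ne_w0; rewrite !ffunE.
case: (w j); case: (w' j) => //.
  by move=> /eqP ne /ne.
by move=> /eqP ne /esym /ne.
Qed.

(** By [essential_eq], [g] takes distinct values at the unit vectors of its essential
    coordinates. *)
Lemma card_essential g : is_term_fun g -> #|essential g| <= #|A|.
Proof.
move=> gP; pose delta j : cube := [ffun i => i == j].
have inj : {in essential g &, injective (fun j => g (delta j))}.
  move=> j j' ess_j _ /(essential_eq gP ess_j); rewrite !ffunE eqxx.
  by move/esym/eqP.
by rewrite -(card_in_imset inj) max_card.
Qed.

Lemma eq_on_essential (g : {ffun cube -> A}) (w w' : cube) :
  {in essential g, w =1 w'} -> g w = g w'.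
Proof.
move=> eq_w; have ffunK (v : cube) : [ffun i => v i] = v by apply/ffunP=> i; rewrite ffunE.
suff : g [ffun i => w' i] = g w by rewrite ffunK.
apply: (upd_ind (w := w) (w' := w') (P := fun v => g [ffun i => v i] = g w)).
  by rewrite ffunK.
move=> w0 i _ w0i <-; have [ess_i|] := boolP (i \in essential g).
  by rewrite -eq_w // -w0i upd_id.
rewrite inE negb_exists => /forallP/(_ [ffun i => w0 i]); rewrite negbK => /eqP eq_i.
have flipE v : [ffun i0 => upd w0 i v i0] = flip [ffun i => w0 i] i v.
  by apply/ffunP=> i0; rewrite !ffunE /upd ffunE.
rewrite -{2}(upd_id w0 i) !flipE.
by case: (w' i); case: (w0 i); rewrite ?eq_i.
Qed.

(** An element is determined by a list of [d] coordinates, its essential ones padded with [ord0],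
    and a table of values on the [2 ^ d] patterns. *)
Lemma card_cube_algebra : #|cube_algebra| <= m.+1 ^ #|A| * #|A| ^ (2 ^ #|A|).
Proof.
pose d := #|A|.
pose proj (e : {ffun 'I_d -> 'I_m.+1}) (w : cube) : {ffun 'I_d -> bool} := [ffun i => w (e i)].
pose junta (p : {ffun 'I_d -> 'I_m.+1} * {ffun {ffun 'I_d -> bool} -> A}) : {ffun cube -> A} :=
  [ffun w => p.2 (proj p.1 w)].
have -> : #|cube_algebra| = #|[set sval g | g : cube_algebra]|.
  by rewrite card_imset //; apply: val_inj.
apply: leq_trans (_ : #|junta @: [set: _]| <= _); last first.
  apply: leq_trans (leq_imset_card _ _) _.
  by rewrite cardsT card_prod !card_ffun card_bool !card_ord.
apply/subset_leq_card/subsetP=> _ /imsetP[[g gP] _ ->] /=.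
pose e : {ffun 'I_d -> 'I_m.+1} := [ffun i : 'I_d => nth ord0 (enum (essential g)) i].
have eP j : j \in essential g -> exists i, e i = j.
  move=> ess_j; have lt_d : index j (enum (essential g)) < d.
    apply: leq_trans (card_essential gP); rewrite cardE index_mem mem_enum //.
  by exists (Ordinal lt_d); rewrite ffunE /= nth_index // mem_enum.
pose h : {ffun {ffun 'I_d -> bool} -> A} :=
  [ffun nu => if [pick w | proj e w == nu] is Some w then g w else b].
apply/imsetP; exists (e, h) => //; apply/ffunP=> w; rewrite !ffunE /=.
case: pickP => [w' /eqP/ffunP eq_w|/(_ w)]; last by rewrite eqxx.
apply: eq_on_essential => j /eP[i <-].
by have := eq_w i; rewrite !ffunE.
Qed.

End LowerBound.

Lemma superpolynomial_lower_bound (F : Type) (ar : F -> nat) (A : algebra ar) k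
    (B : {set A}) (HB : subuniverse B) (alpha : subalg HB -> subalg HB -> Prop) :
  cA_bigO_pow A k -> congruence alpha -> strongly_abelian alpha -> ~ nontrivial_rel alpha.
Proof.
case=> c [n0 bound] congr_a sa_a [a [b [ne_ab ab]]].
pose d := #|subalg HB|; pose D := d ^ (2 ^ d).
have d_gt0 : 0 < d by apply/card_gt0P; exists a.
(* At [n = m.+1 ^ d * D], which bounds the size of the cube algebra, the assumed bound [c * n ^ k]
   equals [c * D ^ k * m.+1 ^ (d * k)], to be beaten by [2 ^ m.+1]. *)
have [m le_m] := exp_dominates_pow (c * D ^ k) (d * k) n0.
rewrite ltnNge => /negP[].
apply: leq_trans (card_Hom_cube ne_ab m) _.
apply: leq_trans (card_Hom_subalg _ HB) _.
rewrite expnM -mulnA [D ^ k * _]mulnC -expnMn.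
apply: bound; last exact: (card_cube_algebra congr_a sa_a ab).
apply: leq_trans le_m (leq_trans (leqnSn m) _).
apply: leq_trans (leq_pmulr _ _); last by rewrite expn_gt0 d_gt0.
by rewrite -{1}(expn1 m.+1) leq_pexp2l.
Qed.

Theorem theorem1p1 (F : Type) (ar : F -> nat) (A : algebra ar) :
  (exists k : nat, cA_bigO_pow A k) <->
  (forall (B : {set A}) (HB : subuniverse B) (alpha : subalg HB -> subalg HB -> Prop),
      congruence alpha -> strongly_abelian alpha -> ~ nontrivial_rel alpha).
Proof.
split; last exact: polynomial_upper_bound.
by case=> k bound B HB alpha; apply: superpolynomial_lower_bound bound.
Qed.
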